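(* There exist universal constants $c_{\lambda_0}>0$ and $C>0$ such that the following holds. In the setting described in the context, let $\lambda\ge 0$ and $\lambda_0\geq c_{\lambda_0}\sigma^2\log(ep)/n$, and let $(\hat\alpha,\hat{\boldsymbol\beta})$ be any global minimiser of $$\frac1n\|\boldsymbol y-\alpha\mathbf 1-\boldsymbol X\boldsymbol\beta\|_2^2+\lambda_0\|\boldsymbol\beta\|_0+\lambda\sum_{j=1}^q\big|\{\beta_k:k\in\mathcal I_j\}\big|$$ over $\alpha\in\mathbb R,\boldsymbol\beta\in\mathbb R^p$. Then, with probability at least $1-4(ep)^{-9}$, $$\frac1n\|\mathbf f^*-\boldsymbol X\hat{\boldsymbol\beta}-\hat\alpha\mathbf 1\|_2^2+\lambda\hat K\le C\Big(\inf_{\boldsymbol\beta\in\mathbb R^p,\alpha\in\mathbb R}\Big\{\frac1n\|\mathbf f^*-\boldsymbol X\boldsymbol\beta-\alpha\mathbf 1\|_2^2+\lambda_0\|\boldsymbol\beta\|_0+\lambda K(\boldsymbol\beta)\Big\}+\frac{\sigma^2\log(ep)}{n}\Big).$$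
   Context: Setting: $q\ge1$ categorical predictors, the $j$-th taking values in $[p_j]=\{1,\dots,p_j\}$, and $N\ge0$ continuous predictors; $p=N+\sum_{j=1}^q p_j$. There are $n$ observations; observation $i$ has categorical values $C^{(i)}_j\in[p_j]$ and continuous values $W^{(i)}_1,\dots,W^{(i)}_N$. The design matrix $\boldsymbol X\in\mathbb R^{n\times p}$ has $i$-th row $(\mathbf 1(C^{(i)}_1=1),\dots,\mathbf 1(C^{(i)}_1=p_1),\dots,\mathbf 1(C^{(i)}_q=1),\dots,\mathbf 1(C^{(i)}_q=p_q),W^{(i)}_1,\dots,W^{(i)}_N)$, where $\mathbf 1(\cdot)$ is the indicator. $\mathcal I_1=\{1,\dots,p_1\}$, $\mathcal I_2=\{p_1+1,\dots,p_1+p_2\}$, etc., are the column index sets of the dummy variables of the categorical predictors. The data are $\boldsymbol y=\mathbf f^*+\boldsymbol\epsilon$ where $\mathbf f^*\in\mathbb R^n$ (an arbitrary mean vector, no model assumed) and $\boldsymbol X$ are deterministic and $\boldsymbol\epsilon\sim\mathcal N(\mathbf 0,\sigma^2\boldsymbol I_n)$. $\mathbf 1\in\mathbb R^n$ also denotes the all-ones vector. $\|\boldsymbol\beta\|_0$ is the number of nonzero entries. For $\boldsymbol\beta\in\mathbb R^p$, $K(\boldsymbol\beta)=\sum_{j=1}^q|\{\beta_i:i\in\mathcal I_j,\beta_i\ne0\}|$ (total number of distinct nonzero coefficient values, counted per categorical predictor), and $\hat K=K(\hat{\boldsymbol\beta})$. Universal constants do not depend on $n,p,q,N,\sigma,\mathbf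 f^*,\boldsymbol X,\lambda,\lambda_0$. *)

(* Defs.v *)
From HB Require Import structures.
From mathcomp Require Import all_boot all_order all_algebra.
From mathcomp Require Import all_classical all_reals all_analysis.
From mathcomp Require Import normal_distribution.

Set Implicit Arguments.
Unset Strict Implicit.
Unset Printing Implicit Defensive.

Import Order.TTheory GRing.Theory Num.Theory.
Local Open Scope classical_set_scope.
Local Open Scope ring_scope.

Section CatDesign.
Variable R : realType.

(* Column index set of the design matrix: the dummy columns I_1, ..., I_q of
   the q categorical predictors (column (j,l) = indicator of level l of
   predictor j), followed by the N continuous columns.  Its cardinality is
   p = N + \sum_j p_j. *)
Definition coef_idx (q : nat) (pj : 'I_q -> nat) (N : nat) : finType :=
  ({j : 'I_q & 'I_(pj j)} + 'I_N)%type.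

Definition num_coefs (q : nat) (pj : 'I_q -> nat) (N : nat) : nat :=
  #|{: coef_idx pj N}|.

Definition design (n q : nat) (pj : 'I_q -> nat) (N : nat)
  (Cat : 'I_n -> forall j : 'I_q, 'I_(pj j)) (W : 'I_n -> 'I_N -> R)
  (i : 'I_n) (k : coef_idx pj N) : R :=
  match k with
  | inl (existT j l) => if Cat i j == l then 1 else 0
  | inr m => W i m
  end.

Definition Xmul (n q : nat) (pj : 'I_q -> nat) (N : nat)
  (X : 'I_n -> coef_idx pj N -> R) (beta : coef_idx pj N -> R) (i : 'I_n) : R :=
  \sum_(k : coef_idx pj N) X i k * beta k.

Definition l0norm (q : nat) (pj : 'I_q -> nat) (N : nat)
  (beta : coef_idx pj N -> R) : nat :=
  #|[set k : coef_idx pj N | beta k != 0]|.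

Definition block_coefs (q : nat) (pj : 'I_q -> nat) (N : nat)
  (beta : coef_idx pj N -> R) (j : 'I_q) : seq R :=
  [seq beta (inl (existT _ j l)) | l <- enum 'I_(pj j)].

Definition nvals (q : nat) (pj : 'I_q -> nat) (N : nat)
  (beta : coef_idx pj N -> R) (j : 'I_q) : nat :=
  size (@undup R (block_coefs beta j)).

Definition Kcount (q : nat) (pj : 'I_q -> nat) (N : nat)
  (beta : coef_idx pj N -> R) : nat :=
  (\sum_(j < q) size (@undup R (seq.filter (fun x : R => x != 0%R) (block_coefs beta j))))%N.

Definition emp_risk (n q : nat) (pj : 'I_q -> nat) (N : nat)
  (X : 'I_n -> coef_idx pj N -> R) (v : 'I_n -> R) (alpha : R)
  (beta : coef_idx pj N -> R) : R :=
  n%:R^-1 * \sum_(i < n) (v i - alpha - Xmul X beta i) ^+ 2.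

Definition objective (n q : nat) (pj : 'I_q -> nat) (N : nat)
  (X : 'I_n -> coef_idx pj N -> R) (lam0 lam : R) (y : 'I_n -> R) (alpha : R)
  (beta : coef_idx pj N -> R) : R :=
  emp_risk X y alpha beta + lam0 * (l0norm beta)%:R
  + lam * \sum_(j < q) (nvals beta j)%:R.

Definition is_global_minimiser (n q : nat) (pj : 'I_q -> nat) (N : nat)
  (X : 'I_n -> coef_idx pj N -> R) (lam0 lam : R) (y : 'I_n -> R) (alpha : R)
  (beta : coef_idx pj N -> R) : Prop :=
  forall (a : R) (b : coef_idx pj N -> R),
    objective X lam0 lam y alpha beta <= objective X lam0 lam y a b.

Definition oracle_inf (n q : nat) (pj : 'I_q -> nat) (N : nat)
  (X : 'I_n -> coef_idx pj N -> R) (lam0 lam : R) (f : 'I_n -> R) : R :=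
  inf [set r : R | exists (b : coef_idx pj N -> R) (a : R),
         r = emp_risk X f a b + lam0 * (l0norm b)%:R + lam * (Kcount b)%:R].

End CatDesign.

(* Mutual independence of a finite family of real random variables:
   product rule for every choice of measurable sets (taking B i = setT
   recovers every subfamily). *)
Definition mutually_independent (R : realType) (d : measure_display)
  (T : measurableType d) (P : probability T R) (n : nat)
  (X : 'I_n -> T -> R) : Prop :=
  forall B : 'I_n -> set R, (forall i, measurable (B i)) ->
    P (\bigcap_(i in [set: 'I_n]) (X i @^-1` B i))
    = (\prod_(i < n) P (X i @^-1` B i))%E.

(* Main.v *)
Require Import Defs.
From HB Require Import structures.
From mathcomp Require Import all_boot all_order all_algebra.
From mathcomp Require Import all_classical all_reals all_analysis.
From mathcomp Require Import normal_distribution measurable_realfun simple_functions.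
From mathcomp Require Import ring lra.

Import Order.TTheory GRing.Theory Num.Theory.
Local Open Scope classical_set_scope.
Local Open Scope ring_scope.

(* The dummies of a block sum to the all-ones vector, so a block without a zero
   could be shifted by one of its values at the expense of the intercept, with
   the same fit, the same number of distinct values and fewer nonzero entries.
   Hence every block of a minimiser contains a zero, and the penalty on the
   number of distinct values may be replaced by K in the basic inequality.  The
   remaining cross term is <eps, v> with v in the span of the constant vector
   and of the columns in the union S of the two supports; it is at most
   |v|^2 / 8 + 2 |Pi_S eps|^2.  The chi-square variable
   |Pi_S eps|^2 / (4 sigma^2) has exponential moment sqrt 2 ^ rank, so
   |Pi_S eps|^2 <= 40 sigma^2 (|S| + 1) ln (ep) simultaneously for all S by a
   union bound over supports, since \sum_S x^|S| = (1 + x)^p; the penalty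
   lam0 |.|_0 absorbs this. *)

(** * Change of variables, from indicators to nonnegative functions *)

Section Transfer.
Import HBNNSimple.
Local Open Scope ereal_scope.

(** Both sides are linear in [g] and stable under increasing limits, so simple functions suffice.
    The weight [h] allows two uses: [h] a density with [Y] the identity, and [h] the product of the
    remaining factors with [Y] one coordinate. *)
Lemma integral_transfer (R : realType) d1 d2 (T : measurableType d1)
    (S : measurableType d2) (mu : {measure set T -> \bar R})
    (nu : {measure set S -> \bar R}) (Y : T -> S) (h : T -> R) (c : R)
    (g : S -> R) :
  measurable_fun setT Y -> measurable_fun setT h -> (forall x, 0 <= h x)%R ->
  (0 <= c)%R ->
  (forall B, measurable B ->
     \int[mu]_x (h x * \1_B (Y x))%:E = c%:E * nu B) ->
  measurable_fun setT g -> (forall y, 0 <= g y)%R ->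
  \int[mu]_x (h x * g (Y x))%:E = c%:E * \int[nu]_y (g y)%:E.
Proof.
move=> mY mh h0 c0 hB mg g0.
have mEg : measurable_fun setT (EFin \o g) by exact/measurable_EFinP.
pose phi := nnsfun_approx measurableT mEg.
have mphi n : measurable_fun setT (phi n) by exact: measurable_funP.
have nd_phi y : {homo (fun n => phi n y) : m n / (m <= n)%N >-> (m <= n)%R}.
  by move=> m n mn; exact/lefP/nd_nnsfun_approx.
have cvg_phi y : EFin \o phi^~ y @ \oo --> (g y)%:E.
  by apply: (@cvg_nnsfun_approx _ _ _ _ measurableT _ mEg) => // x _;
    rewrite /= lee_fin.
have step n : \int[mu]_x (h x * phi n (Y x))%:E
              = c%:E * \int[nu]_y (phi n y)%:E.
  have mind k : measurable (phi n @^-1` [set k]).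
    by rewrite -[X in measurable X]setTI; exact: mphi.
  transitivity (\sum_(k \in range (phi n))
      \int[mu]_x (k * (h x * \1_(phi n @^-1` [set k]) (Y x)))%:E).
    rewrite -ge0_integral_fsum//.
    - apply: eq_integral => x _.
      rewrite fsumEFin//; congr EFin.
      rewrite [in LHS](fimfunE (phi n)) mulr_fsumr//.
      apply: eq_fsbigr => k _; exact: mulrCA.
    - move=> k; apply/measurable_EFinP; apply: measurable_funM => //.
      apply: measurable_funM => //.
      by apply: measurableT_comp => //; exact: measurable_indic.
    (* Nonnegativity holds for every real [k]: for negative [k] the preimage is empty. *)
    - move=> k x _; rewrite lee_fin mulrCA mulr_ge0//.
      have := nnfun_muleindic_ge0 (phi n) k (Y x).
      by rewrite lee_fin.
  rewrite integralT_nnsfun sintegralE ge0_mule_fsumr; last first.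
    move=> k; exact: nnsfun_mulemu_ge0.
  apply: eq_fsbigr => k /[!inE] -[y _ yk].
  have k0 : (0 <= k)%R by rewrite -yk.
  under eq_integral do rewrite EFinM.
  rewrite ge0_integralZl_EFin//; last 2 first.
  - by move=> x _; rewrite lee_fin mulr_ge0.
  - apply/measurable_EFinP; apply: measurable_funM => //.
    by apply: measurableT_comp => //; exact: measurable_indic.
  by rewrite hB// muleCA.
transitivity (limn (fun n => \int[mu]_x (h x * phi n (Y x))%:E)).
  rewrite -monotone_convergence//.
  - apply: eq_integral => x _; apply/esym/cvg_lim => //.
    under eq_fun do rewrite EFinM.
    by rewrite EFinM; apply: cvgeZl => //; exact: cvg_phi.
  - move=> n; apply/measurable_EFinP; apply: measurable_funM => //.
    exact: measurableT_comp.
  - by move=> n x _; rewrite lee_fin mulr_ge0.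
  - by move=> x _ m n mn; rewrite lee_fin ler_wpM2l// nd_phi.
under eq_fun do rewrite step.
apply/cvg_lim => //; apply: cvgeZl => //.
rewrite (_ : (fun y => (g y)%:E) = (fun y => limn (fun n => (phi n y)%:E))).
  apply: cvg_monotone_convergence => //.
  - by move=> n; apply/measurable_EFinP.
  - by move=> n x _; rewrite lee_fin.
  - by move=> x _ m n mn; rewrite lee_fin nd_phi.
by apply/funext => y; apply/esym/cvg_lim => //; exact: cvg_phi.
Qed.

End Transfer.

(** * Gaussian exponential integrals *)

Section GaussianIntegrals.
Variable R : realType.

Lemma integral_normal_prob_density (m s : R) (g : R -> R) :
  measurable_fun setT g -> (forall y, 0 <= g y) ->
  (\int[normal_prob m s]_x (g x)%:E
   = \int[lebesgue_measure]_x (normal_pdf m s x * g x)%:E)%E.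
Proof.
move=> mg g0.
rewrite (@integral_transfer R _ _ _ _ lebesgue_measure (normal_prob m s) id
  (normal_pdf m s) 1 g) ?mul1e//.
- exact: measurable_normal_pdf.
- by move=> x; exact: normal_pdf_ge0.
move=> B mB; rewrite mul1e /normal_prob [RHS]integral_mkcond.
apply: eq_integral => x _; rewrite /patch indicE.
by case: ifPn => _; rewrite ?mulr1 ?mulr0.
Qed.

(** Completing the square turns the integrand into a constant times the density centred at
    [s ^+ 2 * a]. *)
Lemma normal_mgf (s a : R) : s != 0 ->
  (\int[normal_prob 0 s]_x (expR (a * x))%:E
   = (expR (s ^+ 2 * a ^+ 2 / 2))%:E)%E.
Proof.
move=> s0; rewrite integral_normal_prob_density//; last first.
  by apply: measurableT_comp => //; exact: mulrl_measurable.
transitivity (\int[lebesgue_measure]_x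
   ((expR (s ^+ 2 * a ^+ 2 / 2))%:E * (normal_pdf (s ^+ 2 * a) s x)%:E))%E.
  apply: eq_integral => x _; rewrite -EFinM !normal_pdfE// /normal_fun; congr EFin.
  rewrite [RHS]mulrCA -[LHS]mulrA -!expRD; congr (_ * expR _).
  by field.
rewrite ge0_integralZl_EFin//.
- by rewrite integral_normal_pdf mule1.
- by move=> x _; rewrite lee_fin normal_pdf_ge0.
- by apply/measurable_EFinP; exact: measurable_normal_pdf.
Qed.

(** Since -x^2/2 + x^2/4 = -x^2/4, the integrand is the density of variance 2 up to the ratio
    [sqrt 2] of the normalising constants. *)
Lemma normal_expR_sqr :
  (\int[normal_prob 0 (1 : R)]_x (expR (x ^+ 2 / 4))%:E = (Num.sqrt 2)%:E)%E.
Proof.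
have s20 : Num.sqrt 2 != 0 :> R by rewrite gt_eqF// sqrtr_gt0.
rewrite integral_normal_prob_density//; last first.
  apply: measurableT_comp => //; apply: measurable_funM => //.
transitivity (\int[lebesgue_measure]_x
   ((Num.sqrt 2 : R)%:E * (normal_pdf 0 (Num.sqrt 2) x)%:E))%E.
  apply: eq_integral => x _; rewrite -EFinM !normal_pdfE ?oner_neq0//.
  rewrite /normal_fun /normal_peak; congr EFin.
  rewrite sqr_sqrtr// expr1n mul1r subr0.
  rewrite -(mulr_natr (2 * pi)) -mulrA sqrtrM//.
  rewrite -(mulr_natr pi) [RHS]mulrA invfM mulrA divff// mul1r -mulrA -expRD.
  by congr (_ * expR _); field.
rewrite ge0_integralZl_EFin//.
- by rewrite integral_normal_pdf mule1.
- by move=> x _; rewrite lee_fin normal_pdf_ge0.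
- by apply/measurable_EFinP; exact: measurable_normal_pdf.
Qed.

End GaussianIntegrals.

(** * Expectation of a product of independent factors *)

Section ProductLaw.
Context d d' (T : measurableType d) (S : measurableType d') (R : realType).
Variables (P : probability T R) (nu : probability S R).
Variables (n : nat) (X : 'I_n -> T -> S).
Hypothesis mX : forall i, measurable_fun setT (X i).
Hypothesis lawX : forall B : 'I_n -> set S, (forall i, measurable (B i)) ->
  P (\bigcap_(i in [set: 'I_n]) (X i @^-1` B i)) = (\prod_(i < n) nu (B i))%E.

(* Induction on the number of factors that need not be indicators. *)
Let expectation_prod_indic_from k (F : 'I_n -> S -> R) (m : 'I_n -> R) :
  (forall i, measurable_fun setT (F i)) -> (forall i x, 0 <= F i x) ->
  (forall i, (\int[nu]_x (F i x)%:E = (m i)%:E)%E) ->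
  (forall i : 'I_n, (k <= i)%N -> exists2 B, measurable B & F i = \1_B) ->
  (\int[P]_w (\prod_i F i (X i w))%:E = (\prod_i m i)%:E)%E.
Proof.
elim: k F m => [|k IH] F m mF F0 Fm FB.
  have /choice[B mFB] : forall i, exists B, measurable B /\ F i = \1_B.
    by move=> i; have [B mB FiB] := FB i (leq0n _); exists B.
  have mB i : measurable (B i) := (mFB i).1.
  have FE i : F i = \1_(B i) := (mFB i).2.
  have mpre i : measurable (X i @^-1` B i).
    by rewrite -[X in measurable X]setTI; exact: mX.
  have mI : measurable (\bigcap_(i in [set: 'I_n]) (X i @^-1` B i)).
    by apply: fin_bigcap_measurable => //; exact: finite_finset.
  transitivity (\int[P]_w (\1_(\bigcap_(i in [set: 'I_n]) (X i @^-1` B i)) w)%:E)%E.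
    apply: eq_integral => w _; congr EFin.
    have [wI|wnI] := pselect ((\bigcap_(i in [set: 'I_n]) (X i @^-1` B i)) w).
      rewrite indicE mem_set// big1// => i _.
      by rewrite FE indicE mem_set//; exact: wI.
    rewrite indicE memNset//.
    have [i niw] : exists i, ~ B i (X i w).
      by apply/existsNP => h; apply: wnI => i _; exact: h.
    by rewrite (bigD1 i)//= FE indicE memNset// mul0r.
  rewrite integral_indic// setIT.
  transitivity (\prod_i nu (B i))%E; first exact: lawX.
  rewrite -prodEFin; apply: eq_bigr => i _.
  by rewrite -Fm FE integral_indic// setIT.
(* For [k >= n] no index lies beyond [k], so the induction hypothesis applies as it is. *)
have [kn|nk] := ltnP k n; last first.
  apply: IH => // i ki.
  by have := leq_ltn_trans ki (ltn_ord i); rewrite ltnNge nk.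
pose i0 := Ordinal kn.
have m0 i : 0 <= m i.
  by rewrite -lee_fin -Fm integral_ge0// => x _; rewrite lee_fin.
rewrite [in RHS](bigD1 i0)//= mulrC EFinM -Fm.
(* With the other factors as weight, the transfer lemma reduces the factor at [i0] to an indicator,
   which the induction hypothesis covers. *)
rewrite -(@integral_transfer _ _ _ _ _ P nu (X i0)
   (fun w => \prod_(i | i != i0) F i (X i w)))//.
- by apply: eq_integral => w _; rewrite [in LHS](bigD1 i0)//= mulrC.
- under eq_fun do rewrite -big_filter.
  by apply: measurable_prod => i _; exact: measurableT_comp.
- by move=> w; apply: prodr_ge0.
- exact: prodr_ge0.
move=> B mB.
pose F' i := if i == i0 then \1_B : S -> R else F i.
pose m' i := if i == i0 then fine (nu B) else m i.
transitivity (\int[P]_w (\prod_i F' i (X i w))%:E)%E.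
  apply: eq_integral => w _; rewrite [in RHS](bigD1 i0)//= /F' eqxx mulrC.
  by congr (_ * _)%:E; apply: eq_bigr => i /negbTE ->.
rewrite (IH F' m'); first last.
- move=> i ki; rewrite /F'; case: ifPn => [_|ii0]; first by exists B.
  apply: FB; rewrite ltn_neqAle ki andbT; apply: contra ii0 => /eqP ki0.
  by apply/eqP/val_inj.
- move=> i; rewrite /F' /m'; case: ifPn => _; last exact: Fm.
  by rewrite integral_indic// setIT fineK// fin_num_measure.
- by move=> i x; rewrite /F'; case: ifPn => // _; rewrite indicE.
- by move=> i; rewrite /F'; case: ifPn => // _; exact: measurable_indic.
rewrite (bigD1 i0)//= /m' eqxx mulrC EFinM fineK ?fin_num_measure//.
by congr (_%:E * _)%E; apply: eq_bigr => i /negbTE ->.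
Qed.

Lemma expectation_prod (F : 'I_n -> S -> R) (m : 'I_n -> R) :
  (forall i, measurable_fun setT (F i)) -> (forall i x, 0 <= F i x) ->
  (forall i, (\int[nu]_x (F i x)%:E = (m i)%:E)%E) ->
  (\int[P]_w (\prod_i F i (X i w))%:E = (\prod_i m i)%:E)%E.
Proof.
move=> mF F0 Fm; apply: (@expectation_prod_indic_from n) => // i.
by rewrite leqNgt ltn_ord.
Qed.

End ProductLaw.

(** * Inner products and orthonormal families *)

Definition dot {R : realType} {n : nat} (u v : 'I_n -> R) : R :=
  \sum_i u i * v i.

(** Indexing by all naturals, with only the first [k] vectors constrained, lets a vector be appended
    without changing the type. *)
Definition orthonormal {R : realType} {n : nat} (k : nat)
    (u : nat -> 'I_n -> R) : Prop :=
  forall i j, (i < k)%N -> (j < k)%N -> dot (u i) (u j) = (i == j)%:R.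

Section Dot.
Variables (R : realType) (n : nat).
Implicit Types u v w : 'I_n -> R.

Lemma dotC u v : dot u v = dot v u.
Proof. by apply: eq_bigr => i _; rewrite mulrC. Qed.

Lemma dotDl u v w : dot (fun i => u i + v i) w = dot u w + dot v w.
Proof. by rewrite -big_split; apply: eq_bigr => i _; rewrite mulrDl. Qed.

Lemma dotZl c u w : dot (fun i => c * u i) w = c * dot u w.
Proof. by rewrite /dot mulr_sumr; apply: eq_bigr => i _; rewrite mulrA. Qed.

Lemma dotBl u v w : dot (fun i => u i - v i) w = dot u w - dot v w.
Proof. by rewrite -sumrB; apply: eq_bigr => i _; rewrite mulrBl. Qed.

Lemma dot_suml k (c : nat -> R) (u : nat -> 'I_n -> R) w :
  dot (fun i => \sum_(l < k) c l * u l i) w = \sum_(l < k) c l * dot (u l) w.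
Proof.
transitivity (\sum_i \sum_(l < k) c l * (u l i * w i)).
  by apply: eq_bigr => i _; rewrite mulr_suml; apply: eq_bigr => l _; rewrite mulrA.
by rewrite exchange_big; apply: eq_bigr => l _; rewrite /dot mulr_sumr.
Qed.

Lemma dot_ge0 u : 0 <= dot u u.
Proof. by apply: sumr_ge0 => i _; rewrite -expr2 sqr_ge0. Qed.

Lemma dot_eq0 u : (dot u u == 0) = [forall i, u i == 0].
Proof.
rewrite psumr_eq0; last by move=> i _; rewrite -expr2 sqr_ge0.
apply/allP/forallP => [h i|h i _]; last by rewrite (eqP (h i)) mulr0 eqxx.
by have := h i (mem_index_enum _); rewrite mulf_eq0 orbb.
Qed.

Lemma dot_orthonormal_sum k (u : nat -> 'I_n -> R) (c : nat -> R) (l : nat) :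
  orthonormal k u -> (l < k)%N ->
  dot (fun i => \sum_(j < k) c j * u j i) (u l) = c l.
Proof.
move=> ou lk; rewrite dot_suml (bigD1 (Ordinal lk))//= ou// eqxx mulr1.
rewrite big1 ?addr0// => j; rewrite -val_eqE/= => jl.
by rewrite ou// (negbTE jl) mulr0.
Qed.

(** Gram-Schmidt along the list. Linearly dependent vectors add nothing to the family, hence only an
    upper bound on [k]. *)
Lemma orthonormal_span (I : eqType) (a : I -> 'I_n -> R) (s : seq I) :
  exists k (u : nat -> 'I_n -> R), [/\ (k <= size s)%N, orthonormal k u &
    forall x, x \in s ->
      exists c : nat -> R, forall i, a x i = \sum_(l < k) c l * u l i].
Proof.
elim: s => [|x s [k [u [ks ou su]]]]; first by exists 0%N, (fun _ _ => 0).
pose c l := dot (a x) (u l).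
pose r i := a x i - \sum_(l < k) c l * u l i.
have ru l : (l < k)%N -> dot r (u l) = 0.
  by move=> lk; rewrite dotBl dot_orthonormal_sum// subrr.
have [r0|r0] := eqVneq (dot r r) 0.
  exists k, u; split=> //; first exact: leqW.
  move=> y; rewrite inE => /predU1P[->|]; last exact: su.
  exists c => i; apply/eqP; rewrite -subr_eq0.
  by move/eqP: r0; rewrite dot_eq0 => /forallP /(_ i).
pose N := Num.sqrt (dot r r).
have N0 : N != 0 by rewrite gt_eqF// sqrtr_gt0 lt_neqAle eq_sym r0 dot_ge0.
pose u' l := if l == k then (fun i => N^-1 * r i) else u l.
have u'E l : (l < k)%N -> u' l = u l by move=> lk; rewrite /u' ltn_eqF.
have u'k : u' k = (fun i => N^-1 * r i) by rewrite /u'; case: eqP.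
clearbody u'.
exists k.+1, u'; split=> //.
  move=> i j; rewrite !ltnS => ik jk.
  have [ik'|ki] := ltnP i k; have [jk'|kj] := ltnP j k.
  - by rewrite !u'E//; exact: ou.
  - have -> : j = k by apply/eqP; rewrite eqn_leq jk.
    by rewrite u'E// u'k dotC dotZl ru// mulr0 ltn_eqF.
  - have -> : i = k by apply/eqP; rewrite eqn_leq ik.
    by rewrite u'k (u'E j)// dotZl ru// mulr0 gtn_eqF.
  have -> : i = k by apply/eqP; rewrite eqn_leq ik.
  have -> : j = k by apply/eqP; rewrite eqn_leq jk.
  rewrite u'k dotZl dotC dotZl eqxx -(sqr_sqrtr (dot_ge0 r)) -/N.
  by rewrite /=; field.
(* The last coordinate [e] contributes [e / N] times the residual: [e = N] recovers the new vector,
   [e = 0] keeps the old expansions. *)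
have ext (b : nat -> R) e i : \sum_(l < k.+1) (if (l : nat) == k then e else b l) * u' l i
    = \sum_(l < k) b l * u l i + e / N * r i.
  rewrite big_ord_recr/= eqxx u'k mulrA; congr (_ + _).
  by apply: eq_bigr => l _; rewrite ltn_eqF// u'E.
move=> y; rewrite inE => /predU1P[->|/su[b yb]].
  exists (fun l => if l == k then N else c l) => i.
  by rewrite ext divff// mul1r /r addrC subrK.
exists (fun l => if l == k then 0 else b l) => i.
by rewrite ext !mul0r addr0.
Qed.

(* Cauchy-Schwarz on the span, then AM-GM. *)
Lemma dot_span_le k (u : nat -> 'I_n -> R) (c : nat -> R) (v e : 'I_n -> R) :
  orthonormal k u -> (forall i, v i = \sum_(l < k) c l * u l i) ->
  2 * dot v e <= dot v v / 4 + 4 * \sum_(l < k) dot (u l) e ^+ 2.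
Proof.
move=> ou /funext ->; rewrite dot_suml dot_suml.
under [X in _ <= X / 4 + _]eq_bigr => l _ do rewrite dotC dot_orthonormal_sum//.
rewrite !mulr_sumr mulr_suml -big_split/=; apply: ler_sum => l _.
rewrite -subr_ge0; have := sqr_ge0 (c l / 2 - 2 * dot (u l) e).
by congr (0 <= _); field.
Qed.

End Dot.

(** * Exponential moment and tail of the projected noise *)

Section ChiSquare.
Context d (T : measurableType d) (R : realType) (P : probability T R).

(* Linearisation of the square by an auxiliary standard Gaussian. *)
Lemma integral_expR_sqr (A B : T -> R) :
  measurable_fun setT A -> measurable_fun setT B ->
  (\int[P]_w (expR (A w + B w ^+ 2 / 2))%:E
   = \int[normal_prob 0 (1 : R)]_g \int[P]_w (expR (A w + g * B w))%:E)%E.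
Proof.
move=> mA mB.
pose f (z : T * measurableTypeR R) : \bar R :=
  (expR (A z.1 + (z.2 : R) * B z.1))%:E.
rewrite -(@fubini_tonelli _ _ _ _ _ P (normal_prob 0 (1:R)) f)/=; first last.
- by move=> z; rewrite lee_fin expR_ge0.
- apply/measurable_EFinP; apply: measurableT_comp => //.
  apply: measurable_funD; first exact: measurableT_comp.
  apply: measurable_funM; first exact: measurable_snd.
  exact: measurableT_comp.
apply: eq_integral => w _; rewrite /f/=.
under [RHS]eq_integral do rewrite expRD EFinM mulrC.
rewrite ge0_integralZl_EFin//.
- by rewrite normal_mgf ?oner_neq0// -EFinM -expRD expr1n mul1r.
- by apply/measurable_EFinP; exact: measurableT_comp.
Qed.

Context (sigma : R) (n : nat) (eps : 'I_n -> T -> R).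
Hypothesis sigma_gt0 : 0 < sigma.
Hypothesis meps : forall i, measurable_fun setT (eps i).
Hypothesis law_eps :
  forall B : 'I_n -> set R, (forall i, measurable (B i)) ->
  P (\bigcap_(i in [set: 'I_n]) (eps i @^-1` B i))
  = (\prod_(i < n) normal_prob 0 sigma (B i))%E.

Lemma measurable_dot (a : 'I_n -> R) :
  measurable_fun setT (fun w => dot a (eps^~ w)).
Proof. by apply: measurable_sum => i; exact: measurable_funM. Qed.

Lemma gaussian_linear_mgf (a : 'I_n -> R) :
  (\int[P]_w (expR (dot a (eps^~ w)))%:E
   = (expR (sigma ^+ 2 * dot a a / 2))%:E)%E.
Proof.
under eq_integral do rewrite /dot expR_sum.
rewrite (@expectation_prod _ _ _ (measurableTypeR R) _ P (normal_prob 0 sigma)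
  n eps meps law_eps (fun i x => expR (a i * x))
  (fun i => expR (sigma ^+ 2 * a i ^+ 2 / 2)))//.
- rewrite -expR_sum; congr (expR _)%:E.
  rewrite /dot mulr_sumr mulr_suml.
  by apply: eq_bigr => i _; rewrite expr2.
- move=> i; apply: measurableT_comp => //; exact: mulrl_measurable.
- by move=> i; rewrite normal_mgf ?gt_eqF.
Qed.

(** Normalised so that half the square of [scale * dot (u k) eps] is the summand with denominator
    [4 * sigma ^+ 2]. *)
Let scale : R := (Num.sqrt 2 * sigma)^-1.

Let scaleE : scale ^+ 2 = (2 * sigma ^+ 2)^-1.
Proof. by rewrite exprVn exprMn sqr_sqrtr. Qed.

(* Linearising the last square adds a multiple of [u k] to [a], hence the
   linear term. *)
Let chi_square_mgf_shift k (u : nat -> 'I_n -> R) (a : 'I_n -> R) :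
  orthonormal k u -> (forall l, (l < k)%N -> dot a (u l) = 0) ->
  (\int[P]_w (expR (dot a (eps^~ w)
     + \sum_(l < k) dot (u l) (eps^~ w) ^+ 2 / (4 * sigma ^+ 2)))%:E
   = (expR (sigma ^+ 2 * dot a a / 2) * Num.sqrt 2 ^+ k)%:E)%E.
Proof.
have s0 : sigma != 0 by rewrite gt_eqF.
elim: k a => [|k IH] a ou au.
  rewrite expr0 mulr1 -gaussian_linear_mgf.
  by apply: eq_integral => w _; rewrite big_ord0 addr0.
pose A w := dot a (eps^~ w)
   + \sum_(l < k) dot (u l) (eps^~ w) ^+ 2 / (4 * sigma ^+ 2).
pose B w := scale * dot (u k) (eps^~ w).
transitivity (\int[P]_w (expR (A w + B w ^+ 2 / 2))%:E)%E.
  apply: eq_integral => w _; rewrite big_ord_recr/= addrA; congr (expR (_ + _))%:E.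
  by rewrite /B exprMn scaleE; field.
rewrite integral_expR_sqr; first last.
- by apply: measurable_funM => //; exact: measurable_dot.
- apply: measurable_funD; first exact: measurable_dot.
  apply: measurable_sum => l; apply: measurable_funM => //.
  by apply: measurable_funX; exact: measurable_dot.
transitivity (\int[normal_prob 0 (1 : R)]_g
  ((expR (sigma ^+ 2 * dot a a / 2) * Num.sqrt 2 ^+ k)%:E *
   (expR (g ^+ 2 / 4))%:E))%E.
  apply: eq_integral => g _.
  (* For fixed [g] one square fewer remains, and [b] is still orthogonal to the first [k] vectors.
     As [a] is orthogonal to [u k], |b|^2 = |a|^2 + g^2 / (2 sigma^2), which leaves the factor
     exp(g^2 / 4). *)
  pose b i := a i + g * scale * u k i.
  transitivity (\int[P]_w (expR (dot b (eps^~ w)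
     + \sum_(l < k) dot (u l) (eps^~ w) ^+ 2 / (4 * sigma ^+ 2)))%:E)%E.
    apply: eq_integral => w _; congr (expR _)%:E.
    by rewrite /A /B /b dotDl dotZl; ring.
  rewrite IH.
  - rewrite -EFinM; congr EFin; rewrite [RHS]mulrAC -expRD; congr (expR _ * _).
    rewrite /b dotDl dotZl [dot a _]dotC [dot (u k) _]dotC !dotDl !dotZl.
    rewrite [dot (u k) a]dotC au// ou// eqxx mulr0 addr0 add0r mulr1.
    rewrite -expr2 exprMn scaleE; field.
    by rewrite s0.
  - by move=> i j ik jk; apply: ou; exact: ltnW.
  - move=> l lk; rewrite /b dotDl dotZl au ?ou ?ltnS ?(ltnW lk)//.
    by rewrite gtn_eqF// mulr0 addr0.
rewrite ge0_integralZl_EFin//.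
- by rewrite normal_expR_sqr -EFinM (exprSr _ k) mulrA.
- by apply/measurable_EFinP; apply: measurableT_comp => //; exact: measurable_funM.
Qed.

Lemma chi_square_mgf k (u : nat -> 'I_n -> R) : orthonormal k u ->
  (\int[P]_w (expR
     ((\sum_(l < k) dot (u l) (eps^~ w) ^+ 2) / (4 * sigma ^+ 2)))%:E
   = (Num.sqrt 2 ^+ k)%:E)%E.
Proof.
move=> ou; pose a := fun _ : 'I_n => 0 : R.
have a0 v : dot a v = 0 by rewrite /dot big1// => i _; rewrite mul0r.
have := chi_square_mgf_shift _ _ a ou (fun l _ => a0 (u l)).
rewrite a0 mulr0 mul0r expR0 mul1r => <-.
by apply: eq_integral => w _; rewrite a0 add0r mulr_suml.
Qed.

Lemma measurable_chi_square_tail k (u : nat -> 'I_n -> R) (t : R) :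
  measurable [set w | t < \sum_(l < k) dot (u l) (eps^~ w) ^+ 2].
Proof.
pose Z w := \sum_(l < k) dot (u l) (eps^~ w) ^+ 2.
have mZ : measurable_fun setT Z.
  apply: measurable_sum => l.
  by apply: measurable_funX; exact: measurable_dot.
rewrite (_ : mkset _ = setT `&` Z @^-1` `]t, +oo[%classic).
  by apply: mZ => //; exact: measurable_itv.
by rewrite setTI; apply/seteqP; split=> w; rewrite /= in_itv/= andbT.
Qed.

(** Chernoff bound: Markov's inequality for the exponential of the sum divided by
    [4 * sigma ^+ 2]. *)
Lemma chi_square_tail k (u : nat -> 'I_n -> R) (t : R) : orthonormal k u ->
  (P [set w | 4 * sigma ^+ 2 * t < \sum_(l < k) dot (u l) (eps^~ w) ^+ 2]%R
   <= (Num.sqrt 2 ^+ k * expR (- t))%:E)%E.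
Proof.
move=> ou; have c0 : 0 < 4 * sigma ^+ 2 by rewrite mulr_gt0// exprn_gt0.
set A := mkset _; have mA : measurable A by exact: measurable_chi_square_tail.
rewrite EFinM expRN lee_pdivlMr ?expR_gt0// muleC.
rewrite -(chi_square_mgf _ _ ou) -[A]setIT -integral_indic//.
rewrite -ge0_integralZl_EFin ?expR_ge0//; last first.
  by apply/measurable_EFinP; exact: measurable_indic.
apply: ge0_le_integral => //.
- by apply/measurable_EFinP; apply: measurable_funM => //; exact: measurable_indic.
- apply/measurable_EFinP; apply: measurableT_comp => //.
  apply: measurable_funM => //; apply: measurable_sum => l.
  by apply: measurable_funX; exact: measurable_dot.
move=> w _; rewrite -EFinM lee_fin indicE.
case: (boolP (w \in A)) => [|_]; last by rewrite mulr0 expR_ge0.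
by rewrite inE /A/= mulr1 ler_expR ler_pdivlMr// mulrC => /ltW.
Qed.

End ChiSquare.

(** * Union bound over supports *)

Section UnionBound.

Lemma probability_bigsetU_le d (T : measurableType d) (R : realType)
    (P : probability T R) (I : Type) (s : seq I) (A : I -> set T) :
  (forall i, measurable (A i)) ->
  (P (\big[setU/set0]_(i <- s) A i) <= \sum_(i <- s) P (A i))%E.
Proof.
move=> mA; elim: s => [|i s IH]; first by rewrite !big_nil measure0.
rewrite !big_cons; apply: (@le_trans _ _ (P (A i) + P (\big[setU/set0]_(j <- s) A j))%E).
  by apply: measureU2 => //; exact: bigsetU_measurable.
by rewrite leeD2l.
Qed.

Lemma sum_expr_card (R : realType) (I : finType) (x : R) :
  \sum_(S : {set I}) x ^+ #|S| = (1 + x) ^+ #|I|.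
Proof.
rewrite -[#|I|]cardsT -prodr_const.
under [RHS]eq_bigl do rewrite inE.
(* [bigA_distr] picks the first summand on the indices of the subset, so [x] has to come first. *)
under [RHS]eq_bigr do rewrite addrC.
rewrite bigA_distr; apply: eq_bigr => S _.
by rewrite -big_mkcond/= prodr_const.
Qed.

(** With y = ep and x = 2 y^-10, the sum is x (1 + x)^p <= x exp(px) <= e x <= x y = 2 y^-9, where
    px <= 1 because 2p <= y. *)
Lemma sum_support_tail_le (R : realType) (I : finType) :
  (0 < #|I|)%N ->
  \sum_(S : {set I}) (2 * (expR 1 * #|I|%:R) ^- 10) ^+ #|S|.+1
    <= 4 * (expR 1 * #|I|%:R) ^- 9 :> R.
Proof.
move=> I0; set y : R := expR 1 * #|I|%:R.
have e2 : 2 <= expR 1 :> R by apply: le_trans (expR_ge1Dx 1).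
have p1 : 1 <= #|I|%:R :> R by rewrite ler1n.
have ey : expR 1 <= y by rewrite /y ler_peMr ?expR_ge0.
have y1 : 1 <= y by lra.
have y0 : 0 < y by lra.
under eq_bigr do rewrite exprS.
rewrite -mulr_sumr sum_expr_card.
have y10 : y ^- 10 = y^-1 * y ^- 9 by rewrite exprS invfM.
have y9 : 0 < y ^- 9 by rewrite invr_gt0 exprn_gt0.
have y9le1 : y ^- 9 <= 1 by rewrite invf_le1 ?exprn_gt0// exprn_ege1.
set x := 2 * y ^- 10.
have x0 : 0 <= x by rewrite mulr_ge0// invr_ge0 exprn_ge0// ltW.
have px : #|I|%:R * x <= 1.
  rewrite /x y10 mulrCA !mulrA.
  apply: mulr_ile1 => //; [|exact: ltW|].
    by apply: divr_ge0; [exact: mulr_ge0|exact: ltW].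
  by rewrite ler_pdivrMr// mul1r /y ler_wpM2r// ltW; lra.
have xI : (1 + x) ^+ #|I| <= expR 1.
  apply: (@le_trans _ _ (expR x ^+ #|I|)).
    by rewrite lerXn2r ?nnegrE ?expR_ge0 ?expR_ge1Dx// addr_ge0.
  by rewrite -expRM_natl ler_expR.
apply: (@le_trans _ _ (x * y)).
  by rewrite ler_wpM2l// (le_trans xI).
rewrite /x y10 -mulrA mulrAC mulVf ?gt_eqF// mul1r.
by rewrite ler_pM2r//; lra.
Qed.

Context d (T : measurableType d) (R : realType) (P : probability T R).
Context (sigma : R) (n : nat) (eps : 'I_n -> T -> R).
Hypothesis sigma_gt0 : 0 < sigma.
Hypothesis meps : forall i, measurable_fun setT (eps i).
Hypothesis law_eps :
  forall B : 'I_n -> set R, (forall i, measurable (B i)) ->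
  P (\bigcap_(i in [set: 'I_n]) (eps i @^-1` B i))
  = (\prod_(i < n) normal_prob 0 sigma (B i))%E.

(** The event is fixed before [S], [a] and [b], so the support may later depend on the noise. For
    each [S] a deterministic orthonormal family spans the constant vector and the columns in [S]. *)
Lemma sparse_noise_event (I : finType) (X : 'I_n -> I -> R) :
  (0 < #|I|)%N ->
  let y := expR 1 * #|I|%:R : R in
  exists E : set T, measurable E /\ ((1 - 4 * y ^- 9)%:E <= P E)%E /\
  forall w, E w -> forall (S : {set I}) (a : R) (b : I -> R),
    (forall k, k \notin S -> b k = 0) ->
    forall v : 'I_n -> R, (forall i, v i = a + \sum_k X i k * b k) ->
    2 * dot v (eps^~ w)
      <= dot v v / 4 + 160 * sigma ^+ 2 * #|S|.+1%:R * ln y.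
Proof.
move=> I0 y.
have e2 : 2 <= expR 1 :> R by apply: le_trans (expR_ge1Dx 1).
have p1 : 1 <= #|I|%:R :> R by rewrite ler1n.
have ey : expR 1 <= y by rewrite /y ler_peMr ?expR_ge0.
have y0 : 0 < y by lra.
(* [None] stands for the intercept column; it accounts for the extra one in [#|S|.+1]. *)
pose col (x : option I) i : R := if x is Some k then X i k else 1.
pose idx (S : {set I}) := None :: [seq Some k | k <- enum S].
have /choice[ku kuP] : forall S : {set I}, exists ku : nat * (nat -> 'I_n -> R),
    [/\ (ku.1 <= #|S|.+1)%N, orthonormal ku.1 ku.2 & forall x, x \in idx S ->
      exists c : nat -> R, forall i, col x i = \sum_(l < ku.1) c l * ku.2 l i].
  move=> S; have [k [u [ks ou su]]] := orthonormal_span _ _ _ col (idx S).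
  by exists (k, u); split=> //; move: ks; rewrite /= size_map -cardE.
pose Z S w := \sum_(l < (ku S).1) dot ((ku S).2 l) (eps^~ w) ^+ 2.
(* Here exp(-t) = y^(-10(|S| + 1)) and sqrt 2 ^ rank <= 2^(|S| + 1), so the tail is at most (2
   y^-10)^(|S| + 1), the summand of the support sum. *)
pose t (S : {set I}) := #|S|.+1%:R * (10 * ln y).
pose bad S := [set w | 4 * sigma ^+ 2 * t S < Z S w].
have mbad S : measurable (bad S) by exact: measurable_chi_square_tail.
have Pbad S : (P (bad S) <= ((2 * y ^- 10) ^+ #|S|.+1)%:E)%E.
  have [ks ou _] := kuP S.
  apply: (le_trans (@chi_square_tail _ _ _ P _ _ _ sigma_gt0 meps law_eps _ _ (t S) ou)).
  rewrite lee_fin exprMn ler_pM ?expR_ge0 ?exprn_ge0//.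
    apply: (@le_trans _ _ (2 ^+ (ku S).1)); last by rewrite ler_eXn2l// ltr1n.
    rewrite lerXn2r ?nnegrE//.
    by rewrite -[leRHS]ger0_norm// -sqrtr_sqr ler_sqrt// expr2; lra.
  rewrite /t -mulrN expRM_natl expRN expRM_natl lnK// exprVn.
exists (~` \big[setU/set0]_(S : {set I}) bad S); split; last split.
- by apply: measurableC; exact: bigsetU_measurable.
- rewrite probability_setC; last exact: bigsetU_measurable.
  rewrite EFinB leeB// (le_trans (@probability_bigsetU_le _ _ _ _ _ _ _ mbad))//.
  apply: (@le_trans _ _ (\sum_(S : {set I}) ((2 * y ^- 10) ^+ #|S|.+1)%:E)%E).
    exact: lee_sum.
  by rewrite sumEFin lee_fin sum_support_tail_le.
move=> w Ew S a b bS v vE0.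
have ZS : Z S w <= 4 * sigma ^+ 2 * t S.
  rewrite leNgt; apply/negP => badS; apply: Ew.
  by rewrite -bigcup_seq; exists S => //=; rewrite mem_index_enum.
have [_ ou su] := kuP S.
(* Choice needs coordinates for every column; those outside [idx S] get the default 0. *)
have /choice[c cP] : forall x, exists c : nat -> R, x \in idx S ->
    forall i, col x i = \sum_(l < (ku S).1) c l * (ku S).2 l i.
  move=> x; have [/su[c cx]|xS] := boolP (x \in idx S); first by exists c.
  by exists (fun=> 0).
pose e l := a * c None l + \sum_(k in S) b k * c (Some k) l.
have vE i : v i = \sum_(l < (ku S).1) e l * (ku S).2 l i.
  rewrite /e vE0 (bigID (mem S))/= [X in _ + (_ + X)]big1 ?addr0; last first.
    by move=> k kS; rewrite bS// mulr0.
  under [RHS]eq_bigr do rewrite mulrDl mulr_suml.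
  rewrite big_split/= exchange_big/=; congr (_ + _).
    have c1 : 1 = \sum_(l < (ku S).1) c None l * (ku S).2 l i.
      exact: (cP None (mem_head _ _) i).
    by rewrite -[LHS]mulr1 [X in a * X]c1 mulr_sumr; apply: eq_bigr => l _; rewrite mulrA.
  apply: eq_bigr => k kS; have := cP (Some k) _ i; rewrite /= => ->.
    by rewrite mulr_suml; apply: eq_bigr => l _; rewrite mulrC mulrA.
  by rewrite inE/= map_f// mem_enum.
apply: (le_trans (@dot_span_le _ _ _ _ e _ (eps^~ w) ou vE)).
rewrite lerD2l -/(Z S w).
apply: (le_trans (ler_wpM2l _ ZS)) => //.
(* 160 = 4 * 4 * 10: the factor of [dot_span_le], the scale [4 * sigma ^+ 2] and the threshold
   [t]. *)
by rewrite le_eqVlt /t; apply/orP; left; apply/eqP; ring.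
Qed.

End UnionBound.

(** * Deterministic analysis of minimisers *)

Section Minimisers.
Variables (R : realType) (n q N : nat) (pj : 'I_q -> nat).
Variables (Cat : 'I_n -> forall j : 'I_q, 'I_(pj j)) (W : 'I_n -> 'I_N -> R).
Implicit Types (b : coef_idx pj N -> R) (j : 'I_q).

Lemma size_undup_nonzero (s : seq R) :
  size (@undup R s)
  = (size (@undup R (seq.filter (fun x : R => x != 0%R) s)) + (0%R \in s))%N.
Proof.
rewrite -filter_undup size_filter -[LHS](count_predC (pred1 (0 : R))) addnC.
by rewrite count_uniq_mem ?undup_uniq// mem_undup.
Qed.

Definition nonzero_vals b j : nat :=
  size (@undup R (seq.filter (fun x : R => x != 0%R) (block_coefs b j))).

Lemma nvals_le b j : (nvals b j <= (nonzero_vals b j).+1)%N.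
Proof. by rewrite /nvals size_undup_nonzero -addn1 leq_add2l leq_b1. Qed.

Definition shift_block b j (v : R) : coef_idx pj N -> R := fun k =>
  match k with
  | inl (existT j' l) => b k - (if j' == j then v else 0)
  | inr _ => b k
  end.

(** In row [i] exactly one dummy of block [j] is 1, that of level [Cat i j], so the fit drops by [v]
    once. *)
Lemma Xmul_shift_block b j v i :
  Xmul (design Cat W) (shift_block b j v) i = Xmul (design Cat W) b i - v.
Proof.
suff h : Xmul (design Cat W) b i - Xmul (design Cat W) (shift_block b j v) i = v.
  by rewrite -[X in _ = _ - X]h subKr.
rewrite /Xmul -sumrB.
rewrite (bigD1 (inl (existT _ j (Cat i j))))//= !eqxx big1 ?addr0; last first.
  move=> [[j' l]|m]; rewrite /= ?subrr// => neq.
  case: eqP => [Cl|_]; last by rewrite !mul0r subrr.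
  case: eqP => [jj|_]; last by rewrite subr0 subrr.
  by subst j'; rewrite Cl eqxx in neq.
by rewrite !mul1r subKr.
Qed.

Lemma nvals_shift_block b j v j' : nvals (shift_block b j v) j' = nvals b j'.
Proof.
rewrite /nvals.
have -> : block_coefs (shift_block b j v) j'
    = [seq x - (if j' == j then v else 0) | x <- block_coefs b j'].
  by rewrite /block_coefs -[RHS]map_comp.
by rewrite undup_map_inj ?size_map//; exact: addIr.
Qed.

(* The set in [l0norm] is a classical one, not a [{set _}]. *)
Lemma l0normE b : l0norm b = #|[pred k | b k != 0]|.
Proof. by apply: eq_card => k; apply/idP/idP; rewrite in_setE inE. Qed.

(** All entries of the block were already nonzero, so the shift creates no new nonzero entry, and it
    annihilates the one at [l0]. *)
Lemma l0norm_shift_block b j (l0 : 'I_(pj j)) :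
  (0 : R) \notin (block_coefs b j) ->
  (l0norm (shift_block b j (b (inl (existT _ j l0)))) < l0norm b)%N.
Proof.
move=> b0; have bj l : b (inl (existT _ j l)) != 0.
  by apply: contra b0 => /eqP <-; apply: map_f; rewrite mem_enum.
rewrite !l0normE; apply: proper_card; apply/fintype.properP; split.
  apply/fintype.subsetP => -[[j' l]|m]; rewrite !inE//=.
  by case: (j' =P j) => [jj _|_]; [subst j'; exact: bj|rewrite subr0].
by exists (inl (existT _ j l0)); rewrite !inE//= eqxx subrr eqxx.
Qed.

(* Otherwise shifting the block by one of its values, and the intercept
   accordingly, would reduce the number of nonzero coefficients. *)
Lemma minimiser_block_zero (lam0 lam : R) (y : 'I_n -> R) (a : R) b j :
  (0 < n)%N -> 0 < lam0 ->
  is_global_minimiser (design Cat W) lam0 lam y a b ->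
  (0 : R) \in (block_coefs b j).
Proof.
move=> n0 lam00 minb; apply/negPn/negP => b0.
(* The first observation supplies a level, so the block is not empty. *)
pose l0 := Cat (Ordinal n0) j; pose v := b (inl (existT _ j l0)).
have := minb (a + v) (shift_block b j v); apply/negP; rewrite -ltNge.
rewrite /objective.
have -> : emp_risk (design Cat W) y (a + v) (shift_block b j v)
        = emp_risk (design Cat W) y a b.
  congr (_ * _); apply: eq_bigr => i _; rewrite Xmul_shift_block.
  by congr (_ ^+ 2); ring.
rewrite (eq_bigr (fun j' => (nvals b j')%:R)); last first.
  by move=> j' _; rewrite nvals_shift_block.
by rewrite ltrD2r ltrD2l ltr_pM2l// ltr_nat l0norm_shift_block.
Qed.

(** The values of a minimiser number exactly K + q, as each block contains 0; those of a competitor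
    number at most K + q. The terms in q cancel. *)
Lemma minimiser_basic_inequality (lam0 lam : R) (y : 'I_n -> R) (ah a : R) bh b :
  (0 < n)%N -> 0 < lam0 -> 0 <= lam ->
  is_global_minimiser (design Cat W) lam0 lam y ah bh ->
  emp_risk (design Cat W) y ah bh + lam0 * (l0norm bh)%:R + lam * (Kcount bh)%:R
  <= emp_risk (design Cat W) y a b + lam0 * (l0norm b)%:R + lam * (Kcount b)%:R.
Proof.
move=> n0 lam00 lam_ge0 minb.
have cnt b' : (\sum_(j < q) (nonzero_vals b' j).+1 = Kcount b' + q)%N.
  by under eq_bigr do rewrite -addn1; rewrite big_split/= sum1_card card_ord.
have hatE : \sum_(j < q) (nvals bh j)%:R = (Kcount bh)%:R + q%:R :> R.
  rewrite -natr_sum -natrD -cnt; congr (_%:R); apply: eq_bigr => j _.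
  rewrite /nvals size_undup_nonzero.
  by rewrite (minimiser_block_zero _ _ _ _ _ _ n0 lam00 minb) addn1.
have bE : \sum_(j < q) (nvals b j)%:R <= (Kcount b)%:R + q%:R :> R.
  rewrite -natr_sum -natrD -cnt ler_nat; apply: leq_sum => j _.
  exact: nvals_le.
have := minb a b; rewrite /objective hatE => hmin.
have := ler_wpM2l lam_ge0 bE; rewrite !mulrDr in hmin * => hb.
lra.
Qed.

(** The noise [e] is a fixed vector here, and [c] stands for sigma^2 ln(ep) / n; probability enters
    only through the noise bound assumed for all [S]. *)
Lemma oracle_inequality (f e : 'I_n -> R) (lam0 lam c : R) (ah : R) bh :
  (0 < n)%N -> 0 < lam0 -> 0 <= lam -> 160 * c <= lam0 -> 0 <= c ->
  (forall (S : {set coef_idx pj N}) (a : R) b,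
    (forall k, k \notin S -> b k = 0) ->
    forall v : 'I_n -> R,
    (forall i, v i = a + \sum_k design Cat W i k * b k) ->
    2 * dot v e <= dot v v / 4 + 160 * n%:R * c * #|S|.+1%:R) ->
  is_global_minimiser (design Cat W) lam0 lam (fun i => f i + e i) ah bh ->
  emp_risk (design Cat W) f ah bh + lam * (Kcount bh)%:R
  <= 320 * (oracle_inf (design Cat W) lam0 lam f + c).
Proof.
move=> n0 lam00 lam_ge0 clam c0 noise minb.
set X := design Cat W.
(* With 320 and [c] moved to the left, a lower bound of a nonempty set is sought, so a single
   competitor can be fixed. *)
rewrite -ler_pdivrMl// -lerBlDr; apply: lb_le_inf.
  by eexists; exists (fun=> 0), 0; reflexivity.
move=> _ [b [a ->]]; rewrite lerBlDr ler_pdivrMl//.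
have /(_ a b) := minimiser_basic_inequality _ _ _ _ _ _ _ n0 lam00 lam_ge0 minb.
rewrite -/X.
pose S : {set coef_idx pj N} := [set k | (bh k != 0) || (b k != 0)]%SET.
pose v i := ah + Xmul X bh i - (a + Xmul X b i).
have nR : 0 < n%:R :> R by rewrite ltr0n.
have vE i : v i = (ah - a) + \sum_k X i k * (bh k - b k).
  rewrite /v /Xmul; under [in RHS]eq_bigr do rewrite mulrBr.
  by rewrite sumrB; ring.
have bS k : k \notin S -> bh k - b k = 0.
  by rewrite !inE negb_or !negbK => /andP[/eqP-> /eqP->]; rewrite subrr.
have cardS : #|S|.+1%:R <= (l0norm bh)%:R + (l0norm b)%:R + 1 :> R.
  rewrite -natrD natr1 ler_nat ltnS.
  by rewrite !l0normE /S cardsE -cardUI leq_addr.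
have := noise S _ _ bS v vE.
pose F (al : R) be := \sum_i (f i - al - Xmul X be i) ^+ 2.
have FE al be : emp_risk X f al be = n%:R^-1 * F al be by [].
have yE : emp_risk X (fun i => f i + e i) ah bh
        - emp_risk X (fun i => f i + e i) a b
        = n%:R^-1 * (F ah bh - F a b - 2 * dot v e).
  rewrite /emp_risk -mulrBr; congr (_ * _).
  rewrite /F /dot mulr_sumr -!sumrB; apply: eq_bigr => i _.
  by rewrite /v; ring.
(* [v] is the difference of the two residuals, and (r - s)^2 <= 2 r^2 + 2 s^2. *)
have vv : dot v v <= 2 * F ah bh + 2 * F a b.
  rewrite /F /dot !mulr_sumr -big_split/=; apply: ler_sum => i _.
  rewrite -subr_ge0; have := sqr_ge0 (f i - ah - Xmul X bh i + (f i - a - Xmul X b i)).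
  by congr (0 <= _); rewrite /v; ring.
have F0 al be : 0 <= F al be by apply: sumr_ge0 => i _; exact: sqr_ge0.
have K0 : 0 <= lam * (Kcount bh)%:R by rewrite mulr_ge0.
have Kb0 : 0 <= lam * (Kcount b)%:R by rewrite mulr_ge0.
have cS := ler_wpM2l (mulr_ge0 (ler0n R 160) c0) cardS.
have sh := ler_wpM2r (ler0n R (l0norm bh)) clam.
have sb := ler_wpM2r (ler0n R (l0norm b)) clam.
have sb0 : 0 <= lam0 * (l0norm b)%:R by rewrite mulr_ge0// ltW.
move=> hnoise hbasic.
have hn : n%:R^-1 * (2 * dot v e)
    <= n%:R^-1 * (F ah bh + F a b) / 2 + 160 * c * #|S|.+1%:R.
  have -> : n%:R^-1 * (F ah bh + F a b) / 2 + 160 * c * #|S|.+1%:R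
      = n%:R^-1 * ((F ah bh + F a b) / 2 + 160 * n%:R * c * #|S|.+1%:R).
    by field; rewrite gt_eqF.
  by rewrite ler_pM2l ?invr_gt0//; lra.
have G0 : 0 <= n%:R^-1 * F a b by rewrite mulr_ge0 ?invr_ge0.
rewrite !FE; move: hn yE hbasic; rewrite !mulrBr !mulrDr => hn yE hbasic.
rewrite !mulrDr in cS.
(* A quarter of |v|^2 costs half of each risk. The noise term on the support of [bh] is cancelled by
   its penalty since [160 * c <= lam0], and the one on the support of [b] doubles its penalty.
   Doubling the inequality gives factors 3, 4 and 2 on the competitor's terms and 320 on [c]. *)
lra.
Qed.

End Minimisers.

(** * Assembly of the oracle inequality *)

Theorem theorem1 (R : realType) :
  exists (c_lam0 Cst : R), 0 < c_lam0 /\ 0 < Cst /\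
  forall (n q N : nat) (pj : 'I_q -> nat)
    (Cat : 'I_n -> forall j : 'I_q, 'I_(pj j)) (W : 'I_n -> 'I_N -> R)
    (fstar : 'I_n -> R) (sigma lam lam0 : R)
    (d : measure_display) (T : measurableType d) (P : probability T R)
    (eps : 'I_n -> T -> R),
    (0 < n)%N -> (0 < q)%N -> 0 < sigma ->
    (forall i, measurable_fun setT (eps i)) ->
    mutually_independent P eps ->
    (forall i (B : set R), measurable B ->
       P (eps i @^-1` B) = normal_prob 0 sigma B) ->
    let p := num_coefs pj N in
    let X := design Cat W in
    0 <= lam ->
    c_lam0 * sigma ^+ 2 * ln (expR 1 * p%:R) / n%:R <= lam0 ->
    exists E : set T, measurable E /\
      ((1 - 4 * (expR 1 * p%:R) ^- 9)%:E <= P E)%E /\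
      forall w, E w ->
      forall (ahat : R) (bhat : coef_idx pj N -> R),
        is_global_minimiser X lam0 lam (fun i => fstar i + eps i w) ahat bhat ->
        emp_risk X fstar ahat bhat + lam * (Kcount bhat)%:R
        <= Cst * (oracle_inf X lam0 lam fstar
                  + sigma ^+ 2 * ln (expR 1 * p%:R) / n%:R).
Proof.
exists 160, 320; split; first by []; split; first by [].
move=> n q N pj Cat W f sigma lam lam0 d T P eps n0 q0 sigma0 meps ind law p X.
move=> lam_ge0 clam.
have law_eps (B : 'I_n -> set R) : (forall i, measurable (B i)) ->
    P (\bigcap_(i in [set: 'I_n]) (eps i @^-1` B i))
    = (\prod_(i < n) normal_prob 0 sigma (B i))%E.
  by move=> mB; rewrite ind//; apply: eq_bigr => i _; exact: law.
have p0 : (0 < p)%N.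
  apply/card_gt0P; pose j := Ordinal q0.
  by exists (inl (existT _ j (Cat (Ordinal n0) j))).
(* The event depends on the noise alone, so it serves all minimisers at once, without any measurable
   selection. *)
have [E [mE [PE hE]]] := @sparse_noise_event _ _ _ P _ _ _ sigma0 meps law_eps _ X p0.
exists E; split=> //; split=> // w Ew ah bh minb.
set c := sigma ^+ 2 * ln (expR 1 * p%:R) / n%:R.
(* ln(ep) >= 1 makes [c], and hence [lam0], strictly positive, as the block-zero argument
   requires. *)
have ln0 : 0 < ln (expR 1 * p%:R) :> R.
  by rewrite lnM ?posrE ?expR_gt0 ?ltr0n// expRK ltr_wpDr// ln_ge0// ler1n.
have nR : 0 < n%:R :> R by rewrite ltr0n.
have c0 : 0 < c by rewrite /c divr_gt0// mulr_gt0// exprn_gt0.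
have clam' : 160 * c <= lam0 by move: clam; rewrite /c -!mulrA.
apply: (@oracle_inequality _ _ _ _ _ _ _ f (eps^~ w)) => //.
- by apply: lt_le_trans clam'; rewrite mulr_gt0.
- exact: ltW.
move=> S a b bS v vE; apply: (le_trans (hE w Ew S a b bS v vE)).
rewrite lerD2l le_eqVlt; apply/orP; left; apply/eqP.
by rewrite /c /p /num_coefs; field; rewrite gt_eqF.
Qed.
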